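(* Let $n\ge 1$ and $\alpha\in(0,1)$. Let the $n$ pairs of hypotheses $(H_{j1},H_{j2})$, $j=1,\dots,n$, be partitioned into $b$ blocks, so that $\mathcal{F}_1=\{H_{ji}: j=1,\dots,n,\ i=1,2\}$ is the disjoint union of subfamilies $\mathcal{F}_{11},\dots,\mathcal{F}_{1b}$, where $\mathcal{F}_{1k}$ consists of $n_k\ge 1$ full pairs and $\sum_{k=1}^b n_k=n$. Suppose assumptions A.1 and A.3$'$ (between-block dependence), stated in the context, hold. Consider the procedure (Procedure 7) which, for each $k=1,\dots,b$, applies to the $2n_k$ $p$-values of $\mathcal{F}_{1k}$ the stepup procedure at level $n_k\alpha/n$, i.e. with critical values $\frac{j}{n_k}\cdot\frac{n_k\alpha}{n}=\frac{j\alpha}{n}$, $j=1,\dots,n_k$, obtaining a set $K_k$ of rejected hypotheses, and then rejects all hypotheses in $\bigcup_{k=1}^b K_k$. Then this procedure strongly controls $\mathrm{FDR}_{\mathcal{F}_1}$ at level $\alpha$; that is, $\mathrm{FDR}_{\mathcal{F}_1}(\theta)\le\alpha$ for every parameter vector $\theta$.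
   Context: Setting. $T_1,\dots,T_n$ are real-valued test statistics whose joint law $\mathrm{Pr}_\theta$ (expectation $E_\theta$) depends on an unknown vector $\theta=(\theta_1,\dots,\theta_n)$ of real parameters. $T_j$ has cumulative distribution function $F_{j,\theta_j}$ depending only on $\theta_j$; $F_{j,0}$ is continuous and symmetric about zero, $F_{j,0}(-t)=1-F_{j,0}(t)$ for all $t$; and $F_{j,\theta_j}(t)$ is non-increasing in $\theta_j$ for each fixed $t$. Hypotheses and $p$-values. For $j=1,\dots,n$: $H_{j1}:\theta_j\le 0$ (versus $\theta_j>0$), with $p$-value $1-F_{j,0}(T_j)$, and $H_{j2}:\theta_j>0$ (versus $\theta_j<0$), with $p$-value $F_{j,0}(T_j)$. Under any $\theta$ exactly one of $H_{j1},H_{j2}$ is true. Let $H_j$ denote the true one and $H_{n+j}$ the false one, with $p$-values $P_j$ and $P_{n+j}=1-P_j$; thus $P_j=1-F_{j,0}(T_j)$ if $\theta_j\le 0$ and $P_j=F_{j,0}(T_j)$ if $\theta_j>0$. Put $I_0=\{1,\dots,n\}$ (indices of the true nulls). The procedure uses only the $p$-values and not the knowledge of which hypotheses are true. Stepup procedure. For a family of $2m$ hypotheses with ordered $p$-values $P_{(1)}\le\dots\le P_{(2m)}$ and associated hypotheses $H_{(1)},\dots,H_{(2m)}$, the stepup procedure with critical values $\alpha_1\le\dots\le\alpha_m$ rejects $H_{(1)},\dots,H_{(i^* )}$ and accepts the rest, where $i^*=\max\{1\le i\le m: P_{(i)}\le\alpha_i\}$ if the maximum exists; otherwise it accepts all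 hypotheses. Error rate. $R_1$ is the total number of rejected hypotheses in $\mathcal{F}_1$, $V_1$ the number of true hypotheses among them, and $\mathrm{FDR}_{\mathcal{F}_1}(\theta)=E_\theta\left(V_1/\max(R_1,1)\right)$. Assumptions. A.1: for each $j\in I_0$ and each $\theta_j$, $\mathrm{Pr}_{\theta_j}\{P_j\le p\}\le p$ for all $0\le p\le 1$, with equality when $\theta_j=0$ (i.e. $P_j\sim U(0,1)$ when $\theta_j=0$). A.3$'$ (between-block dependence): for each $k=1,\dots,b$, the test statistics corresponding to the true null hypotheses within the subfamily $\mathcal{F}_{1k}$ (i.e. the $T_j$ for the $n_k$ pairs in block $k$) are mutually independent; no assumption is made on the dependence between different blocks. *)

(* Defs.v *)
From HB Require Import structures.
From mathcomp Require Import all_boot all_order all_algebra.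
From mathcomp Require Import all_classical all_reals all_analysis.

Set Implicit Arguments.
Unset Strict Implicit.
Unset Printing Implicit Defensive.

Import Order.TTheory GRing.Theory Num.Theory.
Import numFieldNormedType.Exports.

Local Open Scope ring_scope.

Section Independence.
Context (d : measure_display) (Omega : measurableType d) (R : realType).

(* Mutual independence of the random variables X i, for i in the finite set A,
   as the product rule over every subfamily. *)
Definition mutually_independent (P : probability Omega R) (I : finType)
    (X : I -> Omega -> R) (A : {set I}) : Prop :=
  forall (J : {set I}) (E : I -> set R),
    J \subset A -> (forall i, measurable (E i)) ->
    P [set w | forall i, i \in J -> E i (X i w)]%classic =
    (\prod_(i in J) P [set w | E i (X i w)]%classic)%E.

End Independence.

Section Stepup.
Context (R : realType) (H : finType).

(* s lists the hypotheses of the family G along nondecreasing p-values: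
   s = [:: H_(1); H_(2); ...]. Tied p-values may be listed in any order. *)
Definition pvalue_ordering (p : H -> R) (G : {set H}) (s : seq H) : Prop :=
  perm_eq s (enum G) /\ sorted (fun h h' => p h <= p h') s.

(* i* = max {1 <= i <= m : P_(i) <= c_i}, and 0 when there is no such i;
   P_(i) is the entry of index i.-1 of the sorted list of p-values. *)
Definition stepup_index (p : H -> R) (s : seq H) (m : nat) (c : nat -> R) : nat :=
  \max_(1 <= i < m.+1 | nth 0 (map p s) i.-1 <= c i) i.

Definition stepup (p : H -> R) (s : seq H) (m : nat) (c : nat -> R) : {set H} :=
  [set h in take (stepup_index p s m c) s].

(* Critical values i / m * level, for i = 1, ..., m. *)
Definition stepup_critical (m : nat) (level : R) (i : nat) : R :=
  i%:R / m%:R * level.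

End Stepup.

Section Directional.
Context (R : realType) (n : nat).

(* (j, false) stands for H_j1 : theta_j <= 0, and (j, true) for
   H_j2 : theta_j > 0. *)
Definition hyp : finType := ('I_n * bool)%type.

Definition is_true_null (theta : 'I_n -> R) (h : hyp) : bool :=
  if h.2 then 0 < theta h.1 else theta h.1 <= 0.

(* F0 j is the c.d.f. of the j-th statistic at theta_j = 0, and t the vector
   of observed statistics. *)
Definition pvalue (F0 : 'I_n -> R -> R) (t : 'I_n -> R) (h : hyp) : R :=
  if h.2 then F0 h.1 (t h.1) else 1 - F0 h.1 (t h.1).

Definition true_pvalue (F0 : 'I_n -> R -> R) (theta t : 'I_n -> R) (j : 'I_n) : R :=
  if theta j <= 0 then pvalue F0 t (j, false) else pvalue F0 t (j, true).

(* The subfamily made of the full pairs whose index lies in A. *)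
Definition subfamily (A : {set 'I_n}) : {set hyp} := [set h : hyp | h.1 \in A].

(* The rejections obtained by applying, to each block B k, the stepup procedure
   at level n_k * alpha / n. The argument ord is the rule that orders the
   p-values of a family; it only matters when there are ties. *)
Definition blockwise_stepup (b : nat) (B : 'I_b -> {set 'I_n}) (alpha : R)
    (ord : (hyp -> R) -> {set hyp} -> seq hyp) (p : hyp -> R) : {set hyp} :=
  \bigcup_(k < b)
    stepup p (ord p (subfamily (B k))) #|B k|
      (stepup_critical #|B k| (#|B k|%:R * alpha / n%:R)).

Definition false_discovery_proportion (theta : 'I_n -> R) (K : {set hyp}) : R :=
  #|[set h in K | is_true_null theta h]|%:R / (maxn #|K| 1)%:R.

End Directional.

(* Main.v *)
(* Write R_k for the number of rejections in block k. Since R_1 >= R_k, the false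
   discovery proportion is at most the sum over the pairs j of 1{H_j rejected}/R_k,
   where k is the block of j, so it suffices to bound each expectation by alpha/n.
   When H_j is rejected, R_k equals the number r of rejections obtained after
   lowering P_j to 0 (and raising its partner 1 - P_j to 1): if the critical value
   reached is below 1/2 the partner does not count, and otherwise every other pair
   of the block already contributes a p-value below it. As r depends only on the
   other pairs of the block, it is independent of P_j; conditioning on those pairs,
   E[1{P_j <= r alpha/n} / r] <= alpha/n. *)
Require Import Defs.
From HB Require Import structures.
From mathcomp Require Import all_boot all_order all_algebra.
From mathcomp Require Import all_classical all_reals all_analysis.
From mathcomp Require Import measurable_realfun lra zify.

Set Implicit Arguments.
Unset Strict Implicit.
Unset Printing Implicit Defensive.

Import Order.TTheory GRing.Theory Num.Theory.
Import numFieldNormedType.Exports.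

Local Open Scope ring_scope.

(** * Largest index at which a counting function reaches the diagonal *)

Definition last_crossing (m : nat) (N : nat -> nat) : nat :=
  \max_(1 <= i < m.+1 | (i <= N i)%N) i.

Lemma last_crossing_le m N : (last_crossing m N <= m)%N.
Proof. by apply/bigmax_leqP_seq => i; rewrite mem_index_iota ltnS => /andP[]. Qed.

Lemma leq_last_crossing m N i :
  (0 < i <= m)%N -> (i <= N i)%N -> (i <= last_crossing m N)%N.
Proof.
move=> im iN; apply: (@leq_bigmax_seq _ _ _ (fun i : nat => i)) => //.
by rewrite mem_index_iota ltnS.
Qed.

(** The default value 0 of an empty maximum satisfies [0 <= N 0], so no existence hypothesis is
    required. *)
Lemma last_crossingP m N :
  (last_crossing m N <= N (last_crossing m N))%N.
Proof.
rewrite /last_crossing; apply: (big_ind (fun x => (x <= N x)%N)) => // x y xN yN.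
by case: (leqP x y).
Qed.

Lemma eq_in_last_crossing m (N M : nat -> nat) :
  (forall i, (0 < i <= m)%N -> N i = M i) -> last_crossing m N = last_crossing m M.
Proof.
move=> NM; rewrite /last_crossing big_nat_cond [RHS]big_nat_cond.
apply: eq_bigl => i; rewrite ltnS.
by case: (boolP (0 < i <= m)%N) => // /NM ->.
Qed.

(** * The stepup procedure expressed through counts of small p-values *)

Section StepupCount.
Context (R : realType) (H : finType) (p : H -> R) (G : {set H}) (s : seq H).
Hypothesis s_ordering : pvalue_ordering p G s.

Let uniq_s : uniq s.
Proof. by case: s_ordering => /perm_uniq -> _; exact: enum_uniq. Qed.

Let mem_s h : (h \in s) = (h \in G).
Proof. by case: s_ordering => /perm_mem -> _; rewrite mem_enum. Qed.

Let size_s : size s = #|G|.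
Proof. by case: s_ordering => /perm_size -> _; rewrite -cardE. Qed.

Let sorted_s : sorted <=%O (map p s).
Proof. by rewrite sorted_map; case: s_ordering. Qed.

(** In a sorted list the entries at most [x] form a prefix. The right-hand side no longer mentions
    [s], so the way ties are broken drops out. *)
Lemma nth_pvalue_le (i : nat) (x : R) : (0 < i <= #|G|)%N ->
  (nth 0 (map p s) i.-1 <= x) = (i <= #|[set h in G | (p h <= x)%R]|)%N.
Proof.
move=> /andP[i0 iG].
have -> : #|[set h in G | p h <= x]| = count (<= x) (map p s).
  rewrite count_map -size_filter -(card_uniqP _) ?filter_uniq//.
  by apply: eq_card => h; rewrite !inE mem_filter mem_s andbC.
apply/idP/idP => [le_x|i_le]; last by apply: nth_count_le; rewrite ?prednK.
rewrite -(cat_take_drop i (map p s)) count_cat.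
have : all (<= x) (take i (map p s)).
  apply/(all_nthP 0) => k; rewrite size_takel ?size_map ?size_s//.
  move=> ki; rewrite nth_take//; apply: le_trans le_x.
  apply: (sorted_leq_nth le_trans le_refl) => //;
    rewrite ?inE ?size_map ?size_s; lia.
rewrite all_count size_takel ?size_map ?size_s//.
by move=> /eqP ->; rewrite leq_addr.
Qed.

Lemma stepup_indexE (m : nat) (c : nat -> R) : (m <= #|G|)%N ->
  stepup_index p s m c =
  last_crossing m (fun i => #|[set h in G | (p h <= c i)%R]|).
Proof.
move=> mG; rewrite /stepup_index /last_crossing big_nat_cond [RHS]big_nat_cond.
apply: eq_bigl => i; rewrite ltnS.
by case: (boolP (0 < i <= m)%N) => // im; rewrite nth_pvalue_le//; lia.
Qed.

Lemma card_stepup (m : nat) (c : nat -> R) : (m <= #|G|)%N ->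
  #|stepup p s m c| = stepup_index p s m c.
Proof.
move=> mG; rewrite cardsE.
have /card_uniqP -> := take_uniq (stepup_index p s m c) uniq_s.
rewrite size_takel// size_s stepup_indexE//.
exact: leq_trans (last_crossing_le _ _) mG.
Qed.

Lemma stepup_sub (m : nat) (c : nat -> R) : stepup p s m c \subset G.
Proof. by apply/fintype.subsetP => h; rewrite inE => /mem_take; rewrite mem_s. Qed.

(** With [r] rejections, [h] is among the first [r] entries of the sorted list, so its p-value is at
    most the [r]-th one, which is at most [c r]. *)
Lemma pvalue_stepup_le (m : nat) (c : nat -> R) (h : H) : (m <= #|G|)%N ->
  h \in stepup p s m c -> p h <= c #|stepup p s m c|.
Proof.
move=> mG hK; rewrite card_stepup//; set r := stepup_index p s m c.
have rE := stepup_indexE c mG; rewrite -/r in rE.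
have r_le : (r <= m)%N by rewrite rE last_crossing_le.
move: hK; rewrite inE -/r => /(nthP h) [i].
rewrite size_takel ?size_s; last by lia.
move=> ir; rewrite nth_take// => <-.
have -> : p (nth h s i) = nth 0 (map p s) i.
  by rewrite (nth_map h) // size_s; lia.
apply: (@le_trans _ _ (nth 0 (map p s) r.-1)).
  apply: (sorted_leq_nth le_trans le_refl) => //;
    rewrite ?inE ?size_map ?size_s; lia.
rewrite nth_pvalue_le; last by lia.
by rewrite rE; exact: last_crossingP.
Qed.

End StepupCount.

(** * Complementary pairs and the leave-one-out rejection count *)

Section Pairs.
Context (R : realType) (n : nat) (A : {set 'I_n}) (p : hyp n -> R).
Hypothesis p_pair : forall i, p (i, false) + p (i, true) = 1.

Lemma card_subfamily : #|subfamily A| = #|A|.*2.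
Proof.
have -> : subfamily A = finset.setX A [set: bool].
  by apply/finset.setP => h; rewrite !inE andbT.
by rewrite cardsX cardsT card_bool muln2.
Qed.

(** The smaller p-value of a pair is at most 1/2, hence at most [x]; [f] selects one such hypothesis
    per pair. *)
Lemma card_pvalues_ge (x : R) : (1 <= x *+ 2) ->
  (#|A| <= #|[set h in subfamily A | (p h <= x)%R]|)%N.
Proof.
move=> x2; pose f i : hyp n := (i, (x < p (i, false))%R).
rewrite -(card_imset (mem A) (f := f)); last by move=> i i' [].
apply/subset_leq_card/fintype.subsetP => _ /imsetP[i iA ->]; rewrite !inE iA /=.
rewrite /f; case: ltP => //= xp; have := p_pair i; lra.
Qed.

End Pairs.

Section LeaveOneOut.
Context (R : realType) (n : nat) (A : {set 'I_n}) (p : hyp n -> R).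
Hypothesis p_pair : forall i, p (i, false) + p (i, true) = 1.
Variables (c : nat -> R) (s : seq (hyp n)).
Hypothesis c_mono : {homo c : i j / (i <= j)%N >-> i <= j}.
Hypothesis s_ordering : pvalue_ordering p (subfamily A) s.

(** Both members of pair [j] are dropped, so that the count does not involve the statistic of index
    [j]. *)
Definition others (j : 'I_n) (x : R) := [set h in subfamily (A :\ j) | p h <= x].

Let m_le : (#|A| <= #|subfamily A|)%N.
Proof. by rewrite card_subfamily -addnn leq_addr. Qed.

(** The successor counts [h] itself, as if its p-value were 0; its partner is never counted. *)
Lemma card_stepup_leave_one_out (h : hyp n) : h \in stepup p s #|A| c ->
  #|stepup p s #|A| c| = last_crossing #|A| (fun i => #|others h.1 (c i)|.+1).
Proof.
move=> hK; have ph := pvalue_stepup_le s_ordering m_le hK.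
have hA : h.1 \in A.
  by have := fintype.subsetP (stepup_sub s_ordering #|A| c) _ hK; rewrite inE.
have KE := stepup_indexE s_ordering c m_le.
rewrite -(card_stepup s_ordering c m_le) in KE.
set r := #|stepup p s #|A| c| in ph KE *.
set N := fun i => #|[set h in subfamily A | (p h <= c i)%R]|.
have r_le : (r <= #|A|)%N by rewrite KE last_crossing_le.
have r_gt0 : (0 < r)%N by apply/card_gt0P; exists h.
have rN : (r <= N r)%N by rewrite KE; exact: last_crossingP.
have NE i : (r <= i)%N -> h |: others h.1 (c i) \subset
    [set h in subfamily A | p h <= c i].
  move=> ri; apply/fintype.subsetP => g; rewrite !inE => /predU1P[->|].
    by rewrite hA (le_trans ph)// c_mono.
  by move=> /andP[/andP[_ ->]].
have h_others i : #|h |: others h.1 (c i)| = #|others h.1 (c i)|.+1.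
  by rewrite cardsU1 !inE eqxx.
apply/eqP; rewrite eqn_leq; apply/andP; split.
  apply: leq_last_crossing; first by rewrite r_gt0.
  (* Below 1/2 the partner of h has a p-value above the critical value. *)
  have [c_small|c_large] := ltP (c r *+ 2) 1.
    rewrite -h_others (leq_trans rN)// subset_leq_card//.
    apply/fintype.subsetP => g; rewrite !inE => /andP[gA gp].
    rewrite gA gp !andbT; case: eqVneq => //= gh.
    have := p_pair h.1; move: ph gp gh; case: (h) (g) => [j b] [i b'].
    rewrite xpair_eqE /=; case: (eqVneq i j) => //= ->.
    by case: b b' => -[]//; lra.
  (* From 1/2 on, each of the [#|A| - 1] other pairs contributes, so the count with [h] is at least
     [#|A| >= r]. *)
  rewrite (leq_trans r_le)// (cardsD1 h.1) hA ltnS.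
  exact: card_pvalues_ge.
(* If [q > r], then [c q >= c r >= p h], so [h] is counted at [q] and [q] is a crossing of the full
   count, contradicting the maximality of [r]. *)
set q := last_crossing _ _; rewrite leqNgt; apply/negP => rq.
have q_le : (q <= r)%N; last by lia.
rewrite [leqRHS]KE; apply: leq_last_crossing; first by rewrite last_crossing_le; lia.
apply: leq_trans (subset_leq_card (NE q (ltnW rq))).
rewrite h_others; exact: last_crossingP.
Qed.

End LeaveOneOut.

(** * Expectations of nonnegative functions and finite sums *)

Section Expectation.
Context (d : measure_display) (Omega : measurableType d) (R : realType).
Variable P : probability Omega R.

(* [f] need not be measurable: the false discovery proportion is not in general,
   since ties are ordered by an arbitrary rule. *)
Lemma le_expectation_nonmeasurable (f g : Omega -> R) :
  (forall w, 0 <= f w) -> (forall w, f w <= g w) -> ('E_P[f] <= 'E_P[g])%E.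
Proof.
move=> f0 fg; rewrite unlock.
rewrite !ge0_integralTE; try by move=> w; rewrite lee_fin// (le_trans (f0 w)).
apply: ereal_sup_le => _ [h /= hf <-]; exists h => //= w.
by rewrite (le_trans (hf w))// lee_fin.
Qed.

Lemma expectation_sum_ge0 (S : Type) (r : seq S) (Q : pred S)
    (f : S -> Omega -> R) :
  (forall i w, 0 <= f i w) -> (forall i, measurable_fun setT (f i)) ->
  ('E_P[fun w => (\sum_(i <- r | Q i) f i w)%R] = \sum_(i <- r | Q i) 'E_P[f i])%E.
Proof.
move=> f0 mf; rewrite unlock.
under eq_integral do rewrite -big_filter -sumEFin.
rewrite ge0_integral_sum//=; first by rewrite big_filter.
- by move=> i; apply/measurable_EFinP.
- by move=> i w _; rewrite lee_fin.
Qed.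

Lemma measurable_scaled_indic (a : R) (D : set Omega) :
  measurable D -> measurable_fun setT (fun w => a * \1_D w).
Proof. by move=> mD; apply: measurable_funM. Qed.

Lemma expectation_scaled_indic (a : R) (D : set Omega) : 0 <= a -> measurable D ->
  ('E_P[fun w => (a * \1_D w)%R] = a%:E * P D)%E.
Proof.
move=> a0 mD; rewrite unlock; under eq_integral do rewrite EFinM.
rewrite ge0_integralZl_EFin//; last exact/measurable_EFinP.
by rewrite integral_indic// setIT.
Qed.

End Expectation.

(** * Independence and conditioning on finitely many labels *)

Section LeaveOneOutIndependence.
Context (d : measure_display) (Omega : measurableType d) (R : realType).
Variables (P : probability Omega R) (I : finType) (X : I -> {mfun Omega >-> R}).
Variable A : {set I}.
Hypothesis X_indep : mutually_independent P (fun i w => X i w) A.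

(** The product rule is used twice: over [A] with [D] in place of [E j], then over [A :\ j] to fold
    the remaining factors back into one probability. *)
Lemma mutually_independent_leave_one_out (j : I) (D : set R) (E : I -> set R) :
  j \in A -> measurable D -> (forall i, measurable (E i)) ->
  P ([set w | D (X j w)] `&`
     [set w | forall i, i \in A :\ j -> E i (X i w)])%classic =
  (P [set w | D (X j w)]%classic *
   P [set w | forall i, i \in A :\ j -> E i (X i w)]%classic)%E.
Proof.
move=> jA mD mE; pose E' i := if i == j then D else E i.
have mE' i : measurable (E' i) by rewrite /E'; case: ifP.
have := X_indep (fintype.subxx A) mE'.
rewrite (big_setD1 j)//= {2}/E' eqxx.
have -> : (\prod_(i in A :\ j) P [set w | E' i (X i w)]%classic =
           \prod_(i in A :\ j) P [set w | E i (X i w)]%classic)%E.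
  by apply: eq_bigr => i; rewrite !inE /E' => /andP[/negbTE ->].
rewrite -(X_indep (finset.subD1set _ _) mE) => <-; congr (P _).
apply/seteqP; split => w /=.
  move=> [Dw Ew] i iA; rewrite /E'; case: eqVneq => [->//|ij].
  by apply: Ew; rewrite !inE ij.
move=> Ew; split; first by have := Ew j jA; rewrite /E' eqxx.
move=> i; rewrite !inE => /andP[/negbTE ij iA].
by have := Ew i iA; rewrite /E' ij.
Qed.

Variables (K : finType) (k0 : K) (Z : I -> R -> K) (j : I).
Hypothesis jA : j \in A.
Hypothesis mZ : forall i k, measurable [set x | Z i x = k].

(* Labels outside [A :\ j] are frozen to [k0], so that the events
   [other_labels w = z] form a partition indexed by a finite type. *)
Definition other_labels (w : Omega) : {ffun I -> K} :=
  [ffun i => if i \in A :\ j then Z i (X i w) else k0].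

(** Gives each cell the product form that independence requires; a [z] that violates the freezing
    has an empty cell. *)
Lemma other_labelsE z : [set w | other_labels w = z]%classic =
  if [forall i, (i \notin A :\ j) ==> (z i == k0)]
  then [set w | forall i, i \in A :\ j -> Z i (X i w) = z i]%classic else classical_sets.set0.
Proof.
case: ifPn => [/forallP zk|/forallPn [i iz]]; apply/seteqP; split => w //=.
- by move=> <- i iA; rewrite ffunE iA.
- move=> Ew; apply/ffunP => i; rewrite ffunE; case: ifPn => iA; first exact: Ew.
  by have := zk i; rewrite iA => /eqP.
- by move=> wz; move: iz; rewrite -wz ffunE negb_imply => /andP[/negbTE ->]; rewrite eqxx.
Qed.

Lemma measurable_other_labels z : measurable [set w | other_labels w = z]%classic.
Proof.
rewrite other_labelsE; case: ifP => // _.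
have -> : [set w | forall i, i \in A :\ j -> Z i (X i w) = z i]%classic =
    (\bigcap_(i in [set i | i \in A :\ j]) X i @^-1` [set x | Z i x = z i])%classic.
  by apply/seteqP; split => w /= Ew i /Ew.
apply: fin_bigcap_measurable; first exact: finite_finset.
by move=> i _; apply: measurable_funPTI.
Qed.

(** At each [w] exactly one of the cell indicators equals 1, so their sum is the constant 1. *)
Lemma sum_probability_other_labels :
  (\sum_z P [set w | other_labels w = z]%classic = 1)%E.
Proof.
transitivity ('E_P[fun w => (\sum_z 1 * \1_[set w | other_labels w = z]%classic w)%R])%E.
  rewrite expectation_sum_ge0//; last first.
    by move=> z; apply/measurable_scaled_indic/measurable_other_labels.
  apply: eq_bigr => z _; rewrite expectation_scaled_indic// ?mul1e//.
  exact: measurable_other_labels.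
rewrite -[RHS](expectation_cst P 1); congr expectation.
apply/funext => w /=; rewrite (bigD1 (other_labels w))//= indicE mem_set// mulr1.
rewrite big1 ?addr0// => z zw; rewrite indicE memNset ?mulr0//= => wz.
by rewrite wz eqxx in zw.
Qed.

(** A discrete form of conditioning on the other variables: [D z] and [a z] are fixed on the cell of
    [z], which is independent of [X j], so each term is at most [beta] times the probability of the
    cell. *)
Lemma leave_one_out_le (D : {ffun I -> K} -> set R) (a : {ffun I -> K} -> R)
    (beta : R) :
  (forall z, measurable (D z)) -> (forall z, 0 <= a z) ->
  (forall z, (a z)%:E * P [set w | D z (X j w)]%classic <= beta%:E)%E ->
  (\sum_z (a z)%:E * P ([set w | D z (X j w)] `&` [set w | other_labels w = z])%classic
   <= beta%:E)%E.
Proof.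
move=> mD a0 aD; rewrite -[leRHS]mule1 -sum_probability_other_labels ge0_sume_distrr//.
apply: lee_sum => z _.
have -> : P ([set w | D z (X j w)] `&` [set w | other_labels w = z])%classic =
    (P [set w | D z (X j w)]%classic * P [set w | other_labels w = z]%classic)%E.
  rewrite other_labelsE; case: ifP => _; last by rewrite setI0 measure0 mule0.
  exact: (mutually_independent_leave_one_out
    (E := fun i => [set x | Z i x = z i]%classic)).
by rewrite muleA lee_wpmul2r.
Qed.

End LeaveOneOutIndependence.

(** * The contribution of one pair within its block *)

Section BlockFDR.
Context (R : realType) (n : nat) (F0 : 'I_n -> R -> R) (A : {set 'I_n}).
Variables (c : nat -> R) (beta : R) (truth : 'I_n -> bool).
Hypothesis mF0 : forall i, measurable_fun setT (F0 i).
Hypothesis cE : forall i, (i <= #|A|)%N -> c i = i%:R * beta.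

(* The comparisons of the two p-values of a pair with the critical values. *)
Definition label := {ffun 'I_#|A|.+1 * bool -> bool}.

(** As [pvalue] reads only coordinate [i] here, the constant vector [fun=> x] makes the label a
    function of one statistic. *)
Definition pvalue_label (i : 'I_n) (x : R) : label :=
  [ffun l : 'I_#|A|.+1 * bool => pvalue F0 (fun=> x) (i, l.2) <= c l.1].

(** The leave-one-out count recovered from labels; [inord i] is exact because [i <= #|A|]. *)
Definition label_index (j : 'I_n) (z : {ffun 'I_n -> label}) : nat :=
  last_crossing #|A|
    (fun i => #|[set h in subfamily (A :\ j) | z h.1 (inord i, h.2)]|.+1).

Lemma measurable_pvalue_le (h : hyp n) (x : R) :
  measurable [set t | pvalue F0 (fun=> t) h <= x].
Proof.
have mp : measurable_fun setT (fun t => pvalue F0 (fun=> t) h).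
  by rewrite /pvalue; case: h => i [] //=; apply: measurable_funB.
rewrite -[X in measurable X]setTI.
have -> : [set t | pvalue F0 (fun=> t) h <= x]%classic =
    ((fun t => pvalue F0 (fun=> t) h) @^-1` `]-oo, x])%classic.
  by apply/seteqP; split => t /=; rewrite in_itv.
exact: mp.
Qed.

Lemma measurable_pvalue_label (i : 'I_n) (k : label) :
  measurable [set x | pvalue_label i x = k].
Proof.
have -> : [set x | pvalue_label i x = k]%classic =
    (\bigcap_(l in [set: 'I_#|A|.+1 * bool])
       [set x | (pvalue F0 (fun=> x) (i, l.2) <= c l.1) = k l])%classic.
  apply/seteqP; split => x /=; first by move=> <- l _; rewrite /= ffunE.
  by move=> xk; apply/ffunP => l; rewrite ffunE xk.
apply: fin_bigcap_measurable; first exact: finite_finset.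
move=> l _; case: (k l); first exact: measurable_pvalue_le.
rewrite [X in measurable X](_ : _ =
    ~` [set x | pvalue F0 (fun=> x) (i, l.2) <= c l.1])%classic.
  by apply: measurableC; exact: measurable_pvalue_le.
by apply/seteqP; split => x /=; [move=> -> | move=> /negP/negbTE].
Qed.

(** Index 1 always crosses, since the count is a successor; the inverse of the index is thus a
    genuine one. *)
Lemma label_index_gt0 (j : 'I_n) (z : {ffun 'I_n -> label}) : j \in A ->
  (0 < label_index j z <= #|A|)%N.
Proof.
move=> jA; rewrite last_crossing_le andbT leq_last_crossing// ltnS leqnn /=.
by apply/card_gt0P; exists j.
Qed.

Context (d : measure_display) (Omega : measurableType d).
Variables (P : probability Omega R) (X : 'I_n -> {mfun Omega >-> R}).
Hypothesis X_indep : mutually_independent P (fun i w => X i w) A.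
Hypothesis superuniform : forall j i, (i <= #|A|)%N ->
  (P [set w | pvalue F0 (fun i => X i w) (j, truth j) <= c i]%R%classic
   <= (c i)%:E)%E.

Let labels (j : 'I_n) (w : Omega) := other_labels X A [ffun=> false] pvalue_label j w.

Let region (j : 'I_n) (z : {ffun 'I_n -> label}) : set Omega :=
  ([set w | pvalue F0 (fun i => X i w) (j, truth j) <= c (label_index j z)] `&`
   [set w | labels j w = z])%classic.

(** This is [1{P_j <= c r} / r] with [r] the leave-one-out index, split over cells where [r] is
    constant to make it visibly measurable. *)
Definition rejection_weight (j : 'I_n) (w : Omega) : R :=
  \sum_z (label_index j z)%:R^-1 * \1_(region j z) w.

Lemma rejection_weight_ge0 j w : 0 <= rejection_weight j w.
Proof. by apply: sumr_ge0 => z _; rewrite mulr_ge0. Qed.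

Let measurable_region j z : measurable (region j z).
Proof.
apply: measurableI; last first.
  by apply: measurable_other_labels => i k; exact: measurable_pvalue_label.
exact: (measurable_funPTI (X j) (measurable_pvalue_le (j, truth j) _)).
Qed.

Lemma measurable_rejection_weight j : measurable_fun setT (rejection_weight j).
Proof. by apply: measurable_sum => z; exact: measurable_scaled_indic. Qed.

Lemma expectation_rejection_weight_le j : j \in A ->
  ('E_P[rejection_weight j] <= beta%:E)%E.
Proof.
move=> jA; rewrite expectation_sum_ge0; last 2 first.
- by move=> z w; rewrite mulr_ge0.
- by move=> z; exact: measurable_scaled_indic.
under eq_bigr do rewrite expectation_scaled_indic//.
apply: (leave_one_out_le X_indep [ffun=> false] jA measurable_pvalue_label
  (D := fun z =>
     [set x | pvalue F0 (fun=> x) (j, truth j) <= c (label_index j z)]%classic)).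
- by move=> z; exact: measurable_pvalue_le.
- by move=> z.
move=> z; have /andP[r0 rA] := label_index_gt0 z jA.
(* Since [c r = r * beta], the weight [1 / r] cancels the index and leaves exactly [beta]. *)
apply: le_trans (lee_wpmul2l _ (superuniform j rA)) _; first by rewrite lee_fin.
by rewrite cE// -EFinM lee_fin mulrA mulVf ?mul1r// pnatr_eq0 -lt0n.
Qed.

(** On rejection the leave-one-out index is the true rejection count, so the summand of the actual
    cell already equals the left-hand side. *)
Lemma inv_card_stepup_le (s : seq (hyp n)) (j : 'I_n) (w : Omega) :
  let p := pvalue F0 (fun i => X i w) in
  {homo c : i i' / (i <= i')%N >-> i <= i'} ->
  pvalue_ordering p (subfamily A) s ->
  (j, truth j) \in stepup p s #|A| c ->
  #|stepup p s #|A| c|%:R^-1 <= rejection_weight j w.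
Proof.
move=> p c_mono s_ord jK.
have p_pair i : p (i, false) + p (i, true) = 1 by rewrite /p /pvalue /= subrK.
have m_le : (#|A| <= #|subfamily A|)%N by rewrite card_subfamily -addnn leq_addr.
have pj := pvalue_stepup_le s_ord m_le jK.
have rE : label_index j (labels j w) = #|stepup p s #|A| c|.
  rewrite (card_stepup_leave_one_out p_pair c_mono s_ord jK).
  apply: eq_in_last_crossing => i /andP[_ iA]; congr _.+1.
  apply: eq_card => h; rewrite !inE.
  case: (boolP ((h.1 != j) && (h.1 \in A))) => //= hA.
  by rewrite !ffunE !inE hA ffunE /= inordK// -surjective_pairing.
rewrite /rejection_weight (bigD1 (labels j w))//= rE indicE mem_set.
  by rewrite mulr1 lerDl sumr_ge0// => z _; rewrite mulr_ge0.
by split => //=; rewrite rE.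
Qed.

End BlockFDR.

(** * Critical values, true nulls, and summation over the blocks *)

Lemma stepup_criticalE (R : realType) (m n i : nat) (alpha : R) : (i <= m)%N ->
  stepup_critical m (m%:R * alpha / n%:R) i = i%:R * (alpha / n%:R).
Proof.
rewrite /stepup_critical; case: m => [|m _].
  by rewrite leqn0 => /eqP ->; rewrite !mul0r.
by rewrite -!mulrA mulKf// pnatr_eq0.
Qed.

Lemma stepup_critical_mono (R : realType) (m : nat) (level : R) : 0 <= level ->
  {homo stepup_critical m level : i j / (i <= j)%N >-> i <= j}.
Proof. by move=> l0 i j ij; rewrite !ler_wpM2r ?invr_ge0// ler_nat. Qed.

Lemma is_true_nullE (R : realType) (n : nat) (theta : 'I_n -> R) (h : hyp n) :
  is_true_null theta h = (h.2 == (0 < theta h.1)).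
Proof. by rewrite /is_true_null; case: h => i [] /=; case: ltP. Qed.

Lemma true_pvalueE (R : realType) (n : nat) (F0 : 'I_n -> R -> R)
    (theta t : 'I_n -> R) (j : 'I_n) :
  true_pvalue F0 theta t j = pvalue F0 t (j, 0 < theta j).
Proof. by rewrite /true_pvalue; case: ltP. Qed.

(** Exactly one hypothesis of each pair is true, so true rejections can be summed over pairs. *)
Lemma card_true_null (R : realType) (n : nat) (theta : 'I_n -> R) (K : {set hyp n}) :
  #|[set h in K | is_true_null theta h]| = (\sum_j ((j, (0 < theta j)%R) \in K))%N.
Proof.
pose f j : hyp n := (j, (0 < theta j)%R).
have f_inj : injective f by move=> i j [].
have -> : [set h in K | is_true_null theta h] = f @: [set j | f j \in K].
  apply/finset.setP => h; rewrite inE is_true_nullE; apply/andP/imsetP.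
    move=> [hK /eqP h2]; exists h.1; rewrite ?inE /f -h2 -?surjective_pairing//.
  by move=> [j]; rewrite inE => fK ->; rewrite /= eqxx.
rewrite card_imset// -sum1_card big_mkcond.
by apply: eq_bigr => j _; rewrite inE; case: (_ \in _).
Qed.

(** The partition makes the block of [j] unique as a set; injectivity of [B] makes its index
    unique. *)
Lemma block_index (n b : nat) (B : 'I_b -> {set 'I_n}) :
  finset.partition [set B k | k : 'I_b] [set: 'I_n] -> injective B ->
  exists kappa : 'I_n -> 'I_b, forall j k, (j \in B k) = (k == kappa j).
Proof.
move=> /and3P[/eqP cB tB _] B_inj.
suff /choice[kappa kP] : forall j, exists k, forall k', (j \in B k') = (k' == k).
  by exists kappa.
move=> j; have : j \in finset.cover [set B k | k : 'I_b] by rewrite cB inE.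
rewrite cover_imset => /finset.bigcupP[k _ jk]; exists k => k'.
apply/idP/eqP => [jk'|->//]; apply: B_inj.
by rewrite -(def_pblock tB (imset_f B _) jk)// -(def_pblock tB (imset_f B _) jk').
Qed.

Theorem theorem6 (R : realType) (n : nat) (alpha : R)
  (d : measure_display) (Omega : measurableType d)
  (Pr : ('I_n -> R) -> probability Omega R)
  (T : 'I_n -> {mfun Omega >-> R})
  (F : 'I_n -> R -> R -> R)
  (b : nat) (B : 'I_b -> {set 'I_n})
  (ord : (hyp n -> R) -> {set hyp n} -> seq (hyp n))
  (n_ge1 : (1 <= n)%N)
  (alpha01 : 0 < alpha < 1)
  (T_cdf : forall (theta : 'I_n -> R) (j : 'I_n) (t : R),
     cdf (T j : {RV (Pr theta) >-> R}) t = (F j (theta j) t)%:E)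
  (F0_continuous : forall j : 'I_n, continuous (F j 0))
  (F0_symmetric : forall (j : 'I_n) (t : R), F j 0 (- t) = 1 - F j 0 t)
  (F_nonincreasing : forall (j : 'I_n) (t u v : R), u <= v -> F j v t <= F j u t)
  (B_inj : injective B)
  (B_partition : finset.partition [set B k | k : 'I_b] [set: 'I_n])
  (ord_ordering : forall (p : hyp n -> R) (G : {set hyp n}),
     pvalue_ordering p G (ord p G))
  (A1_le : forall (theta : 'I_n -> R) (j : 'I_n) (p : R), 0 <= p <= 1 ->
     (Pr theta [set w | true_pvalue (fun i => F i 0%R) theta (fun i => T i w) j <= p]%R%classic
        <= p%:E)%E)
  (A1_eq : forall (theta : 'I_n -> R) (j : 'I_n) (p : R), 0 <= p <= 1 ->
     theta j = 0 ->
     Pr theta [set w | true_pvalue (fun i => F i 0%R) theta (fun i => T i w) j <= p]%R%classic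
       = p%:E)
  (A3' : forall (theta : 'I_n -> R) (k : 'I_b),
     mutually_independent (Pr theta) (fun j w => T j w) (B k)) :
  forall theta : 'I_n -> R,
    ('E_(Pr theta)[fun w =>
       false_discovery_proportion theta
         (blockwise_stepup B alpha ord
            (pvalue (fun i => F i 0%R) (fun i => T i w)))] <= alpha%:E)%E.
Proof.
move=> theta; set F0 := fun i => F i 0.
have /andP[alpha_gt0 alpha_lt1] := alpha01.
have n_gt0 : (0 : R) < n%:R by rewrite ltr0n.
pose beta := alpha / n%:R.
have beta_ge0 : 0 <= beta by rewrite divr_ge0// ltW.
pose truth j := 0 < theta j.
pose c k := stepup_critical (R := R) #|B k| (#|B k|%:R * alpha / n%:R).
have cE k i : (i <= #|B k|)%N -> c k i = i%:R * beta by exact: stepup_criticalE.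
have c_mono k : {homo c k : i j / (i <= j)%N >-> i <= j}.
  by apply: stepup_critical_mono; rewrite divr_ge0 ?mulr_ge0// ltW.
have mF0 i : measurable_fun setT (F0 i) by apply: continuous_measurable_fun; exact: F0_continuous.
have superuniform k j i : (i <= #|B k|)%N ->
    (Pr theta [set w | pvalue F0 (fun i => T i w) (j, truth j) <= c k i]%R%classic
     <= (c k i)%:E)%E.
  move=> iB; have i_le_n : (i <= n)%N.
    by rewrite (leq_trans iB)// -[leqRHS]card_ord max_card.
  (* The bounds [i <= n] and [alpha < 1] keep the critical value in the range covered by A.1. *)
  have c01 : 0 <= c k i <= 1.
    rewrite cE// mulr_ge0//= /beta mulrA ler_pdivrMr// mul1r.
    by rewrite (le_trans (ler_piMr _ (ltW alpha_lt1)))// ler_nat.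
  by have := A1_le theta j _ c01; under eq_set do rewrite true_pvalueE.
have [kappa kappaP] := block_index B_partition B_inj.
pose W j := rejection_weight F0 (B (kappa j)) (c (kappa j)) truth T j.
apply: (@le_trans _ _ 'E_(Pr theta)[fun w => (\sum_j W j w)%R])%E.
  apply: le_expectation_nonmeasurable => w; first by rewrite divr_ge0.
  set p := pvalue _ _; set K := blockwise_stepup _ _ _ _.
  rewrite /false_discovery_proportion card_true_null natr_sum mulr_suml.
  apply: ler_sum => j _; case: (boolP (_ \in K)) => [jK|_]; last first.
    by rewrite mul0r rejection_weight_ge0.
  have /finset.bigcupP[k _ jKk] := jK.
  have jB : j \in B k.
    have := fintype.subsetP
      (stepup_sub (ord_ordering p (subfamily (B k))) _ _) _ jKk.
    by rewrite inE.
  move: jB jKk; rewrite kappaP => /eqP -> jKk; rewrite mul1r.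
  have := inv_card_stepup_le (truth := truth) (c_mono _) (ord_ordering p _) jKk.
  have K_gt0 : (0 < #|stepup p (ord p (subfamily (B (kappa j))))
      #|B (kappa j)| (c (kappa j))|)%N.
    by apply/card_gt0P; exists (j, truth j).
  (* The rejections of the block of [j] are among all rejections, so the inverse of the total is at
     most that of the block. *)
  apply: le_trans; rewrite lef_pV2 ?posrE ?ltr0n ?leq_max ?orbT//.
  rewrite ler_nat leq_max; apply/orP; left; apply/subset_leq_card.
  exact: (finset.bigcup_sup (kappa j)).
rewrite expectation_sum_ge0; last 2 first.
- by move=> j w; exact: rejection_weight_ge0.
- by move=> j; exact: measurable_rejection_weight.
apply: (@le_trans _ _ (\sum_(j < n) beta%:E)%E).
  apply: lee_sum => j _; apply: (expectation_rejection_weight_le mF0 (cE _)).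
  - exact: A3'.
  - exact: superuniform.
  - by rewrite kappaP.
by rewrite sumEFin lee_fin sumr_const card_ord -mulr_natr divfK// gt_eqF.
Qed.
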